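(* Let $R$ be a Hopf $k$-algebra and let $A = A(R,\widehat{X}_+,\widehat{X}_-,\sigma,h,\xi)$ be an ambiskew algebra that is a Hopf algebra with $R$ as a Hopf subalgebra and with $$\Delta(\widehat{X}_{\pm}) = \widehat{X}_{\pm}\otimes 1 + y_{\pm}\otimes\widehat{X}_{\pm}$$ for suitable $y_{\pm}\in G(R)$. Put $\chi := \varepsilon\circ\sigma : R\to k$ and $z := y_-y_+$ (recall that then $h\in P_{1,z}(R)$ and $\xi=\chi(y_+)=\chi(y_-)$). Then at least one of the following holds: (i) $\xi = \pm 1$ and $\chi(h)=0$; (ii) $\xi = \pm 1$ and $z = 1$; (iii) $\xi\neq\pm 1$ and $h = \dfrac{\chi(h)}{\xi^2-1}(z-1)$.
   Context: $k$ is an arbitrary field; Hopf algebras have bijective antipode. Given a $k$-algebra $R$, a $k$-algebra automorphism $\sigma$ of $R$, a central element $h\in R$, and a nonzero $\xi\in k$, the ambiskew algebra $A(R,X_+,X_-,\sigma,h,\xi)$ is the $k$-algebra generated by $R$ and $X_+,X_-$ subject to $X_+r=\sigma(r)X_+$, $X_-r=\sigma^{-1}(r)X_-$ ($r\in R$), $X_+X_-=h+\xi X_-X_+$. $G(R)$ is the group of grouplike elements, $\Delta$ the comultiplication and $\varepsilon$ the counit; $P_{1,z}(R)=\{a\in R:\Delta(a)=a\otimes 1+z\otimes a\}$. *)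

(* Defs.v *)
From HB Require Import structures.
From mathcomp Require Import all_boot all_order all_algebra.
From mathcomp Require Import boolp.

Set Implicit Arguments.
Unset Strict Implicit.
Unset Printing Implicit Defensive.

Import GRing.Theory.
Local Open Scope ring_scope.
Local Open Scope quotient_scope.

Reserved Notation "U ⊗ V" (at level 35, right associativity).
Reserved Notation "u ⊗' v" (at level 35, right associativity).

(* The tensor product of two k-vector spaces: formal sums of pairs (u, v),
   modulo the relation "equal under every bilinear map".  [tlift_spec] and
   [tlift_uniq] below are its universal property. *)

Notation bilinear_map f := (bilinear_for *:%R *:%R f).

Section TensorProduct.
Variables (k : fieldType) (U V : lmodType k).

Definition tsum (W : lmodType k) (f : U -> V -> W) (s : seq (U * V)) : W :=
  \sum_(p <- s) f p.1 p.2.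

Definition tens_eqv (s t : seq (U * V)) : bool :=
  `[< forall (W : lmodType k) (f : U -> V -> W),
        bilinear_map f -> tsum f s = tsum f t >].

Fact tens_eqv_refl : reflexive tens_eqv.
Proof. by move=> s; apply/asboolP. Qed.

Fact tens_eqv_sym : symmetric tens_eqv.
Proof.
by move=> s t; apply/asboolP/asboolP => st W f bf; rewrite (st W f bf).
Qed.

Fact tens_eqv_trans : transitive tens_eqv.
Proof.
move=> t s u /asboolP st /asboolP tu; apply/asboolP => W f bf.
by rewrite (st W f bf) (tu W f bf).
Qed.

Canonical tens_equiv :=
  EquivRel tens_eqv tens_eqv_refl tens_eqv_sym tens_eqv_trans.

Definition tensor := {eq_quot tens_eqv}.

HB.instance Definition _ : EqQuotient _ tens_eqv tensor := EqQuotient.on tensor.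
HB.instance Definition _ := Choice.on tensor.

Definition tpure (u : U) (v : V) : tensor := \pi_tensor [:: (u, v)].

(* Meaningful when f is bilinear. *)
Definition tlift (W : lmodType k) (f : U -> V -> W) (t : tensor) : W :=
  tsum f (repr t).

Lemma tlift_pi (W : lmodType k) (f : U -> V -> W) s :
  bilinear_map f -> tlift f (\pi_tensor s) = tsum f s.
Proof.
move=> bf; have /eqP : repr (\pi_tensor s) = s %[mod tensor] by rewrite reprK.
by rewrite eqmodE => /asboolP; apply.
Qed.

Lemma tensor_ext (s t : tensor) :
  (forall (W : lmodType k) (f : U -> V -> W),
     bilinear_map f -> tlift f s = tlift f t) -> s = t.
Proof.
move=> st; rewrite -[s]reprK -[t]reprK; apply/eqP.
by rewrite eqmodE; apply/asboolP.
Qed.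

Definition tens_zero : tensor := \pi_tensor [::].
Definition tens_add (s t : tensor) : tensor := \pi_tensor (repr s ++ repr t).
Definition tens_scale (a : k) (t : tensor) : tensor :=
  \pi_tensor [seq (a *: p.1, p.2) | p <- repr t].
Definition tens_opp (t : tensor) : tensor := tens_scale (-1) t.

Section LiftBilinear.
Variables (W : lmodType k) (f : U -> V -> W) (bf : bilinear_map f).

Fact tlift_zero : tlift f tens_zero = 0.
Proof. by rewrite tlift_pi // /tsum big_nil. Qed.

Fact tlift_add s t : tlift f (tens_add s t) = tlift f s + tlift f t.
Proof. by rewrite tlift_pi // /tsum big_cat. Qed.

Fact tlift_scale a t : tlift f (tens_scale a t) = a *: tlift f t.
Proof.
rewrite tlift_pi // /tsum big_map scaler_sumr.
apply: eq_bigr => p _ /=.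
exact: (scalable_linear (bf.1 p.2)).
Qed.

Fact tlift_opp t : tlift f (tens_opp t) = - tlift f t.
Proof. by rewrite tlift_scale scaleN1r. Qed.

End LiftBilinear.

Fact tens_addA : associative tens_add.
Proof. by move=> s t u; apply: tensor_ext => W f bf; rewrite !tlift_add ?addrA. Qed.

Fact tens_addC : commutative tens_add.
Proof. by move=> s t; apply: tensor_ext => W f bf; rewrite !tlift_add // addrC. Qed.

Fact tens_add0 : left_id tens_zero tens_add.
Proof.
by move=> s; apply: tensor_ext => W f bf; rewrite tlift_add // tlift_zero // add0r.
Qed.

Fact tens_addN : left_inverse tens_zero tens_opp tens_add.
Proof.
move=> s; apply: tensor_ext => W f bf.
by rewrite tlift_add // tlift_opp // tlift_zero // addNr.
Qed.

HB.instance Definition _ :=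
  GRing.isZmodule.Build tensor tens_addA tens_addC tens_add0 tens_addN.

Fact tens_scaleA a b t : tens_scale a (tens_scale b t) = tens_scale (a * b) t.
Proof. by apply: tensor_ext => W f bf; rewrite !tlift_scale // scalerA. Qed.

Fact tens_scale1 : left_id 1 tens_scale.
Proof. by move=> t; apply: tensor_ext => W f bf; rewrite tlift_scale // scale1r. Qed.

Fact tens_scaleDr : right_distributive tens_scale +%R.
Proof.
move=> a s t; apply: tensor_ext => W f bf.
by rewrite tlift_scale // !tlift_add // !tlift_scale // scalerDr.
Qed.

Fact tens_scaleDl t : {morph tens_scale^~ t : a b / a + b}.
Proof.
move=> a b; apply: tensor_ext => W f bf.
by rewrite tlift_add // !tlift_scale // scalerDl.
Qed.

HB.instance Definition _ := GRing.Zmodule_isLmodule.Build k tensor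
  tens_scaleA tens_scale1 tens_scaleDr tens_scaleDl.

Lemma tlift_linear (W : lmodType k) (f : U -> V -> W) :
  bilinear_map f -> linear (tlift f).
Proof. by move=> bf a s t; rewrite tlift_add // tlift_scale. Qed.

Lemma tlift_pure (W : lmodType k) (f : U -> V -> W) u v :
  bilinear_map f -> tlift f (tpure u v) = f u v.
Proof. by move=> bf; rewrite tlift_pi // /tsum big_seq1. Qed.

Lemma tpure_bilinear : bilinear_map tpure.
Proof.
split=> [v a u u' | u a v v']; apply: tensor_ext => W f bf;
  rewrite (tlift_linear bf) !tlift_pure //; [exact: bf.1 | exact: bf.2].
Qed.

Lemma tensor_sum (t : tensor) : t = \sum_(p <- repr t) tpure p.1 p.2.
Proof.
apply: tensor_ext => W f bf; rewrite {1}/tlift /tsum.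
elim: (repr t) => [|p s IHs]; first by rewrite !big_nil (tlift_zero bf).
by rewrite !big_cons (tlift_add bf) tlift_pure // IHs.
Qed.

Lemma tensor_ind (P : tensor -> Prop) :
  P 0 -> (forall u v t, P t -> P (tpure u v + t)) -> forall t, P t.
Proof.
move=> P0 PD t; rewrite (tensor_sum t).
elim: (repr t) => [|p s IHs]; first by rewrite big_nil.
by rewrite big_cons; apply: PD.
Qed.

Theorem tlift_spec (W : lmodType k) (f : U -> V -> W) : bilinear_map f ->
  linear (tlift f) /\ forall u v, tlift f (tpure u v) = f u v.
Proof.
by move=> bf; split=> [|u v]; [exact: tlift_linear | exact: tlift_pure].
Qed.

Theorem tlift_uniq (W : lmodType k) (g h : {linear tensor -> W}) :
  (forall u v, g (tpure u v) = h (tpure u v)) -> g =1 h.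
Proof.
move=> gh; elim/tensor_ind => [|u v t IHt]; first by rewrite !linear0.
by rewrite !linearD gh IHt.
Qed.

End TensorProduct.

Notation "U ⊗ V" := (tensor U V) : type_scope.
Notation "u ⊗' v" := (tpure u v) : ring_scope.

Section TensorMaps.
Variable k : fieldType.

(* f ⊗ g, meaningful when f and g are linear. *)
Definition tmap (U V U' V' : lmodType k) (f : U -> U') (g : V -> V') :
  U ⊗ V -> U' ⊗ V' := tlift (fun u v => f u ⊗' g v).

Definition tassoc (U V W : lmodType k) : (U ⊗ V) ⊗ W -> U ⊗ (V ⊗ W) :=
  tlift (fun t w => tlift (fun u v => u ⊗' (v ⊗' w)) t).

End TensorMaps.

(* The algebra structure (a ⊗ b)(c ⊗ d) = ac ⊗ bd.  Only a pzRingType is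
   declared: this avoids proving 1 ⊗ 1 <> 0, which needs choice of a linear
   form, and is all that is needed to speak of algebra morphisms into A ⊗ B. *)
Section TensorAlgebra.
Variables (k : fieldType) (A B : algType k).
Implicit Types (s t u : A ⊗ B).

Definition tmul s t : A ⊗ B :=
  tlift (fun a b => tlift (fun c d => (a * c) ⊗' (b * d)) t) s.

Fact tmul_inner_bilinear (a : A) (b : B) :
  bilinear_map (fun c d => (a * c) ⊗' (b * d)).
Proof.
split=> [d l c c' | c l d d'] /=.
  by rewrite mulrDr -scalerAr (tpure_bilinear A B).1.
by rewrite mulrDr -scalerAr (tpure_bilinear A B).2.
Qed.

Fact tmul_outer_bilinear t :
  bilinear_map (fun a b => tlift (fun c d => (a * c) ⊗' (b * d)) t).
Proof.
split=> [b l a a' | a l b b'] /=.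
  elim/tensor_ind: t => [|c d t IHt].
    by rewrite !tlift_zero ?scaler0 ?addr0 //; exact: tmul_inner_bilinear.
  rewrite !tlift_add ?IHt; try exact: tmul_inner_bilinear.
  rewrite !tlift_pure; try exact: tmul_inner_bilinear.
  rewrite mulrDl -scalerAl (tpure_bilinear A B).1.
  by rewrite scalerDr addrACA.
elim/tensor_ind: t => [|c d t IHt].
  by rewrite !tlift_zero ?scaler0 ?addr0 //; exact: tmul_inner_bilinear.
rewrite !tlift_add ?IHt; try exact: tmul_inner_bilinear.
rewrite !tlift_pure; try exact: tmul_inner_bilinear.
rewrite mulrDl -scalerAl (tpure_bilinear A B).2.
by rewrite scalerDr addrACA.
Qed.

Lemma tmul_pure a b c d : tmul (a ⊗' b) (c ⊗' d) = (a * c) ⊗' (b * d).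
Proof.
rewrite /tmul tlift_pure; last exact: tmul_outer_bilinear.
by rewrite tlift_pure //; exact: tmul_inner_bilinear.
Qed.

Fact tmulZDl l s s' t : tmul (l *: s + s') t = l *: tmul s t + tmul s' t.
Proof. exact: (tlift_linear (tmul_outer_bilinear t)). Qed.

Fact tmulZDr l s t t' : tmul s (l *: t + t') = l *: tmul s t + tmul s t'.
Proof.
elim/tensor_ind: s => [|a b s IHs].
  by rewrite /tmul !tlift_zero ?scaler0 ?addr0 //; exact: tmul_outer_bilinear.
have bo r := tmul_outer_bilinear r.
have E r : tmul (a ⊗' b + s) r
    = tlift (fun c d => (a * c) ⊗' (b * d)) r + tmul s r.
  by rewrite /tmul tlift_add // tlift_pure.
rewrite !E IHs (tlift_linear (tmul_inner_bilinear a b)).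
by rewrite scalerDr addrACA.
Qed.

Fact tmulDl : left_distributive tmul +%R.
Proof. by move=> s s' t; rewrite -{1}[s]scale1r tmulZDl scale1r. Qed.

Fact tmulDr : right_distributive tmul +%R.
Proof. by move=> s t t'; rewrite -{1}[t]scale1r tmulZDr scale1r. Qed.

Fact tmul0l t : tmul 0 t = 0.
Proof. by apply: (addrI (tmul 0 t)); rewrite -tmulDl !addr0. Qed.

Fact tmul0r t : tmul t 0 = 0.
Proof. by apply: (addrI (tmul t 0)); rewrite -tmulDr !addr0. Qed.

Fact tmulA : associative tmul.
Proof.
move=> s t u; elim/tensor_ind: s => [|a b s IHs]; first by rewrite !tmul0l.
rewrite !tmulDl IHs; congr (_ + _); clear s IHs.
elim/tensor_ind: t => [|c d t IHt]; first by rewrite tmul0r !tmul0l tmul0r.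
rewrite tmulDl !tmulDr tmulDl IHt; congr (_ + _); clear t IHt.
elim/tensor_ind: u => [|e f u IHu]; first by rewrite !tmul0r.
by rewrite !tmulDr IHu !tmul_pure !mulrA.
Qed.

Fact tmul1l : left_id (1 ⊗' 1) tmul.
Proof.
elim/tensor_ind => [|a b t IHt]; first by rewrite tmul0r.
by rewrite tmulDr IHt tmul_pure !mul1r.
Qed.

Fact tmul1r : right_id (1 ⊗' 1) tmul.
Proof.
elim/tensor_ind => [|a b t IHt]; first by rewrite tmul0l.
by rewrite tmulDl IHt tmul_pure !mulr1.
Qed.

HB.instance Definition _ := GRing.Zmodule_isPzRing.Build (A ⊗ B)%type
  tmulA tmul1l tmul1r tmulDl tmulDr.

End TensorAlgebra.

HB.mixin Record isHopfAlgebra (k : fieldType) A of GRing.Algebra k A := {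
  comul : A -> A ⊗ A;
  counit : A -> k;
  antipode : A -> A;
  comul_linear : linear comul;
  comul_monoid_morphism : monoid_morphism comul;
  counit_linear : scalar counit;
  counit_monoid_morphism : monoid_morphism counit;
  antipode_linear : linear antipode;
  antipode_bij : bijective antipode;
  comulA : forall a, tassoc (tmap comul idfun (comul a))
                     = tmap idfun comul (comul a);
  counitl : forall a, tlift (fun b c => counit b *: c) (comul a) = a;
  counitr : forall a, tlift (fun b c => counit c *: b) (comul a) = a;
  antipodel : forall a, tlift (fun b c => antipode b * c) (comul a)
                        = (counit a)%:A;
  antipoder : forall a, tlift (fun b c => b * antipode c) (comul a)
                        = (counit a)%:A
}.

#[short(type="hopfAlgType")]
HB.structure Definition HopfAlgebra (k : fieldType) :=
  {A of isHopfAlgebra k A & GRing.Algebra k A}.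

Section HopfTheory.
Variables (k : fieldType) (A : hopfAlgType k).

HB.instance Definition _ :=
  GRing.isLinear.Build k A (A ⊗ A)%type *:%R (@comul k A) comul_linear.
HB.instance Definition _ :=
  GRing.isMonoidMorphism.Build A (A ⊗ A)%type (@comul k A)
    comul_monoid_morphism.
HB.instance Definition _ :=
  GRing.isLinear.Build k A k *%R (@counit k A) counit_linear.
HB.instance Definition _ :=
  GRing.isMonoidMorphism.Build A k (@counit k A) counit_monoid_morphism.
HB.instance Definition _ :=
  GRing.isLinear.Build k A A *:%R (@antipode k A) antipode_linear.

Definition grouplike (g : A) : Prop := comul g = g ⊗' g /\ counit g = 1.

End HopfTheory.

Definition hopf_embedding (k : fieldType) (R A : hopfAlgType k)
    (i : {lrmorphism R -> A}) : Prop :=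
  [/\ injective i,
      forall r, comul (i r) = tmap i i (comul r),
      forall r, counit (i r) = counit r
    & forall r, antipode (i r) = i (antipode r)].

Section Ambiskew.
Variables (k : fieldType) (R : algType k).
Variables (sigma sigmaV : R -> R) (h : R) (xi : k).

Definition ambiskew_relations (B : algType k) (phi : R -> B) (xp xm : B) : Prop :=
  [/\ forall r, xp * phi r = phi (sigma r) * xp,
      forall r, xm * phi r = phi (sigmaV r) * xm
    & xp * xm = phi h + xi *: (xm * xp)].

(* A is the k-algebra generated by R and Xp, Xm subject to the relations above:
   it is initial among the k-algebras under R with two such elements. *)
Definition is_ambiskew (A : algType k) (i : {lrmorphism R -> A}) (Xp Xm : A)
    : Prop :=
  ambiskew_relations i Xp Xm /\
  forall (B : algType k) (phi : {lrmorphism R -> B}) (xp xm : B),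
    ambiskew_relations phi xp xm ->
    (exists f : {lrmorphism A -> B}, [/\ f \o i =1 phi, f Xp = xp & f Xm = xm])
    /\ (forall f g : {lrmorphism A -> B},
          f \o i =1 phi -> f Xp = xp -> f Xm = xm ->
          g \o i =1 phi -> g Xp = xp -> g Xm = xm -> f =1 g).

End Ambiskew.

(* Main.v *)
(* The relation [Xp * r = sigma r * Xp] and the comultiplication of [Xp] show that
   [sigma] is the left winding map of [chi], and that [sigma r * yp] is [yp] times
   the right winding of [r].  Comultiplying [Xp * Xm = h + xi Xm * Xp] gives
   [sigma ym = xi ym], [sigma yp = xi yp], [yp * ym = ym * yp] and
   [Delta h = h ⊗ 1 + z ⊗ h].  As [h] is central, the two windings yield
   [sigma h = chi h + xi ^ 2 h = h + chi h z], that is,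
   [(xi ^ 2 - 1) h = chi h (z - 1)], and the three cases follow.

   Comparing coefficients requires 1, Xp, Xm and Xm * Xp to be independent over R
   in A.  This is read off from the weight representations of A on sequences
   [int -> R]: R acts at position [n] through [sigma ^ n], Xp shifts, and Xm shifts
   back and multiplies by a central [u n] with [u (n + 1) = sigma ^ n h + xi u n],
   where [u 0] may be any scalar. *)
Require Import Defs.
From HB Require Import structures.
From mathcomp Require Import all_boot all_order all_algebra.
From mathcomp Require Import boolp functions.

Set Implicit Arguments.
Unset Strict Implicit.
Unset Printing Implicit Defensive.

Import GRing.Theory.
Local Open Scope ring_scope.

(** * The k-algebra of linear operators on two-sided sequences in R *)

Section SequenceOperators.
Variables (k : fieldType) (R : algType k).

Definition seqop_pred : {pred (int -> R) -> (int -> R)} :=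
  fun F => `[< linear F >].

(** A subtype of the function space, so that the module structure is inherited pointwise and only
    composition remains to be added as product. The result serves as a target for the universal
    property of A. *)
Record seqop := SeqOp { seqop_fun :> (int -> R) -> int -> R;
                        _ : seqop_fun \in seqop_pred }.

HB.instance Definition _ := [isSub for seqop_fun].
HB.instance Definition _ := [Choice of seqop by <:].

Lemma seqopP (F : seqop) : linear F.
Proof. by case: F => F HF; apply/asboolP. Qed.

Fact seqop_submod_closed : submod_closed seqop_pred.
Proof.
split=> [|a F G /asboolP linF /asboolP linG]; apply/asboolP => b u v.
  by apply/esym; rewrite -[RHS](scaler0 _ b) -[RHS]addr0.
rewrite -[LHS]/(a *: F (b *: u + v) + G (b *: u + v)).
by rewrite linF linG !scalerDr !scalerA mulrC addrACA.
Qed.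

HB.instance Definition _ :=
  GRing.isSubmodClosed.Build k _ seqop_pred seqop_submod_closed.
HB.instance Definition _ := [SubChoice_isSubLmodule of seqop by <:].
HB.instance Definition _ (F : seqop) :=
  GRing.isLinear.Build k (int -> R) (int -> R) *:%R F (seqopP F).

Fact seqop_id_subproof : idfun \in seqop_pred.
Proof. exact/asboolP. Qed.

Fact seqop_comp_subproof (F G : seqop) : F \o G \in seqop_pred.
Proof. by apply/asboolP => a u v /=; rewrite !linearP. Qed.

Definition seqop_one := SeqOp seqop_id_subproof.
Definition seqop_mul F G := SeqOp (seqop_comp_subproof F G).

Fact seqop_mulA : associative seqop_mul.
Proof. by move=> F G H; apply: val_inj. Qed.

Fact seqop_mul1 : left_id seqop_one seqop_mul.
Proof. by move=> F; apply: val_inj. Qed.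

Fact seqop_mulr1 : right_id seqop_one seqop_mul.
Proof. by move=> F; apply: val_inj. Qed.

Fact seqop_mulDl : left_distributive seqop_mul +%R.
Proof. by move=> F G H; apply: val_inj. Qed.

Fact seqop_mulDr : right_distributive seqop_mul +%R.
Proof.
by move=> F G H; apply: val_inj; apply/funext => u; rewrite /= fctE linearD.
Qed.

Fact seqop_one_neq0 : seqop_one != 0.
Proof.
apply/eqP => /(congr1 (fun F : seqop => F (cst 1) 0)) /eqP.
by rewrite (_ : (0 : seqop) (cst 1) 0 = 0) // oner_eq0.
Qed.

HB.instance Definition _ := GRing.Zmodule_isNzRing.Build seqop
  seqop_mulA seqop_mul1 seqop_mulr1 seqop_mulDl seqop_mulDr seqop_one_neq0.

Fact seqop_scaleAl (a : k) (F G : seqop) : a *: (F * G) = (a *: F) * G.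
Proof. by apply: val_inj. Qed.

HB.instance Definition _ := GRing.Lmodule_isLalgebra.Build k seqop seqop_scaleAl.

Fact seqop_scaleAr (a : k) (F G : seqop) : a *: (F * G) = F * (a *: G).
Proof. by apply: val_inj; apply/funext => u; rewrite /= fctE linearZ. Qed.

HB.instance Definition _ := GRing.Lalgebra_isAlgebra.Build k seqop seqop_scaleAr.

End SequenceOperators.

(** * Weight representations of A and coordinates over R *)

Section AmbiskewRepresentation.
Variables (k : fieldType) (R : algType k) (sigma : {lrmorphism R -> R}).
Variables (sigmaV : R -> R) (sigmaK : cancel sigma sigmaV).
Variables (sigmaVK : cancel sigmaV sigma).
Variables (h : R) (xi : k) (xi_neq0 : xi != 0).
Hypothesis h_central : forall r : R, h * r = r * h.

(** A pair holds the data at one position: the map through which R acts there and the factor used by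
    Xm. [weight_pred] solves the same recurrence backwards, which is where [xi] must be
    invertible. *)
Definition weight_succ (s : (R -> R) * R) : (R -> R) * R :=
  (s.1 \o sigma, s.1 h + xi *: s.2).

Definition weight_pred (s : (R -> R) * R) : (R -> R) * R :=
  (s.1 \o sigmaV, xi^-1 *: (s.2 - s.1 (sigmaV h))).

(* The n-th term is (sigma ^ n, u n), where u 0 = l%:A and
   u (n + 1) = sigma ^ n h + xi u n. *)
Definition weight (l : k) (n : int) : (R -> R) * R :=
  match n with
  | Posz m => iter m weight_succ (idfun, l%:A)
  | Negz m => iter m.+1 weight_pred (idfun, l%:A)
  end.

Lemma weight_predK s : weight_succ (weight_pred s) = s.
Proof.
case: s => tau u; rewrite /weight_succ /weight_pred /=; congr pair.
  by apply/funext => r /=; rewrite sigmaK.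
by rewrite scalerA divff // scale1r addrC subrK.
Qed.

Lemma weightS l n : weight l (n + 1) = weight_succ (weight l n).
Proof.
case: n => [m|[|m]]; first by rewrite -PoszD addn1.
  by rewrite [RHS]weight_predK.
have -> : Negz m.+1 + 1 = Negz m by rewrite !NegzE -addn1 PoszD opprD addrNK.
by rewrite [RHS]weight_predK.
Qed.

Lemma sigmaV_linear : linear sigmaV.
Proof. by move=> a r s; apply: (can_inj sigmaK); rewrite linearP /= !sigmaVK. Qed.

Lemma sigmaV_monoid_morphism : monoid_morphism sigmaV.
Proof.
split=> [|r s]; apply: (can_inj sigmaK); first by rewrite sigmaVK rmorph1.
by rewrite rmorphM /= !sigmaVK.
Qed.

(** The last clause amounts to centrality of [u n], since [sigma ^ n] is onto. *)
Definition weight_spec (s : (R -> R) * R) : Prop :=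
  [/\ linear s.1, monoid_morphism s.1 & forall r, s.2 * s.1 r = s.1 r * s.2].

Lemma weight_succ_spec s : weight_spec s -> weight_spec (weight_succ s).
Proof.
case=> lin [mul1 mulM] comm; split=> [a x y|| r] /=.
- by rewrite linearP lin.
- by split=> [|x y] /=; rewrite ?rmorph1 // rmorphM mulM.
- by rewrite mulrDl mulrDr -!mulM h_central -scalerAl -scalerAr comm.
Qed.

Lemma weight_pred_spec s : weight_spec s -> weight_spec (weight_pred s).
Proof.
case=> lin [mul1 mulM] comm; split=> [a x y|| r] /=.
- by rewrite sigmaV_linear lin.
- split=> [|x y] /=; first by rewrite sigmaV_monoid_morphism.1.
  by rewrite sigmaV_monoid_morphism.2 mulM.
- rewrite -scalerAl -scalerAr mulrBl mulrBr comm -!mulM.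
  by rewrite -!sigmaV_monoid_morphism.2 h_central.
Qed.

Lemma weightP l n : weight_spec (weight l n).
Proof.
have w0 : weight_spec (idfun, l%:A).
  by split=> // r /=; rewrite mulr_algl mulr_algr.
case: n => m /=; first by elim: m => //= m; apply: weight_succ_spec.
by apply: weight_pred_spec; elim: m => //= m; apply: weight_pred_spec.
Qed.

Section WeightOperators.
Variable l : k.
Notation tau n := (weight l n).1.
Notation u n := (weight l n).2.

Lemma weight_sigma n r : tau n (sigma r) = tau (n + 1) r.
Proof. by rewrite weightS. Qed.

Fact scal_subproof (r : R) :
  (fun (f : int -> R) n => tau n r * f n) \in @seqop_pred k R.
Proof.
by apply/asboolP => a f g; apply/funext => n; rewrite mulrDr -scalerAr.
Qed.

Fact raise_subproof : (fun (f : int -> R) n => f (n + 1)) \in @seqop_pred k R.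
Proof. by apply/asboolP => a f g; apply/funext => n. Qed.

Fact lower_subproof :
  (fun (f : int -> R) n => u n * f (n - 1)) \in @seqop_pred k R.
Proof.
by apply/asboolP => a f g; apply/funext => n; rewrite mulrDr -scalerAr.
Qed.

Definition scal r : seqop R := SeqOp (scal_subproof r).
Definition raise : seqop R := SeqOp raise_subproof.
Definition lower : seqop R := SeqOp lower_subproof.

Fact scal_linear : linear scal.
Proof.
move=> a r s; apply: val_inj; apply/funext => f; apply/funext => n.
have [lin _ _] := weightP l n.
by rewrite /= lin mulrDl -scalerAl.
Qed.

Fact scal_monoid_morphism : monoid_morphism scal.
Proof.
split=> [|r s]; apply: val_inj; apply/funext => f; apply/funext => n;
  have [_ [mul1 mulM] _] := weightP l n.
  by rewrite /= mul1 mul1r.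
by rewrite /= mulM mulrA.
Qed.

HB.instance Definition _ := GRing.isLinear.Build k R (seqop R) *:%R scal
  scal_linear.
HB.instance Definition _ :=
  GRing.isMonoidMorphism.Build R (seqop R) scal scal_monoid_morphism.

(** The relation for Xp Xm at position [n] is exactly the recurrence for [u (n + 1)]; the one for Xm
    also needs [u n] to commute with the action of R. *)
Lemma weight_ambiskew : ambiskew_relations sigma sigmaV h xi scal raise lower.
Proof.
split=> [r|r|]; apply: val_inj; apply/funext => f; apply/funext => n /=.
- by rewrite weight_sigma.
- have [_ _ comm] := weightP l n.
  (* At position [n - 1], [r = sigma (sigmaV r)] acts as [sigmaV r] does at [n]. *)
  rewrite -[in LHS](sigmaVK r) weight_sigma subrK.
  by rewrite !mulrA comm.
- rewrite -[RHS]/(tau n h * f n + xi *: (u n * f (n - 1 + 1))).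
  by rewrite weightS /= addrK subrK mulrDl -scalerAl.
Qed.

End WeightOperators.

(* Evaluating at 0 the action of A on the sequence f.  It is the freedom in l
   that separates 1 from Xm * Xp. *)
Lemma ambiskew_eval (A : algType k) (i : {lrmorphism R -> A}) (Xp Xm : A)
    (l : k) (f : int -> R) :
  is_ambiskew sigma sigmaV h xi i Xp Xm ->
  exists p : {linear A -> R},
    [/\ forall a, p (i a) = a * f 0,
        forall a, p (i a * Xp) = a * f 1,
        forall a, p (i a * Xm) = l *: (a * f (- 1))
      & forall a, p (i a * (Xm * Xp)) = l *: (a * f 0)].
Proof.
case=> _ /(_ (seqop R) (scal l) _ _ (weight_ambiskew l)) [[g [gi gp gm]] _].
have plin : linear (fun x => g x f 0).
  by move=> a x y; rewrite linearP.
pose p : {linear A -> R} :=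
  HB.pack (fun x => g x f 0) (GRing.isLinear.Build k A R *:%R _ plin).
exists p; split=> a; rewrite /p /=.
- by rewrite -[g (i a)]/((g \o i) a) gi.
- by rewrite rmorphM /= gp -[g (i a)]/((g \o i) a) gi.
- rewrite rmorphM /= gm -[g (i a)]/((g \o i) a) gi /=.
  by rewrite -scalerAl mul1r -scalerAr.
- rewrite !rmorphM /= gp gm -[g (i a)]/((g \o i) a) gi /=.
  by rewrite -scalerAl mul1r -scalerAr.
Qed.

(** Taking one of the four scalars to be 1 and the others 0 gives the coordinate maps that allow
    coefficients to be compared. *)
Lemma ambiskew_coord (A : algType k) (i : {lrmorphism R -> A}) (Xp Xm : A)
    (c1 cp cm cu : k) :
  is_ambiskew sigma sigmaV h xi i Xp Xm ->
  exists p : {linear A -> R},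
    [/\ forall a, p (i a) = c1 *: a,
        forall a, p (i a * Xp) = cp *: a,
        forall a, p (i a * Xm) = cm *: a
      & forall a, p (i a * (Xm * Xp)) = cu *: a].
Proof.
move=> amb.
(* With [l = 0], Xm and Xm * Xp evaluate to 0, so [f0] settles 1 and Xp. With [l = 1], [f1] settles
   Xm and Xm * Xp but adds [cu] to the coefficient of 1; [f2] at [l = 0] removes that excess. *)
pose f0 (n : int) : R := if n == 0 then c1%:A else if n == 1 then cp%:A else 0.
pose f1 (n : int) : R := if n == 0 then cu%:A else if n == - 1 then cm%:A else 0.
pose f2 (n : int) : R := if n == 0 then cu%:A else 0.
have [p0 [p01 p0p p0m p0u]] := ambiskew_eval 0 f0 amb.
have [p1 [p11 p1p p1m p1u]] := ambiskew_eval 1 f1 amb.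
have [p2 [p21 p2p p2m p2u]] := ambiskew_eval 0 f2 amb.
exists (p0 \+ (p1 \- p2)); split=> a /=.
- by rewrite p01 p11 p21 subrr addr0 mulr_algr.
- by rewrite p0p p1p p2p !mulr0 subrr addr0 mulr_algr.
- by rewrite p0m p1m p2m !scale0r scale1r add0r subr0 mulr_algr.
- by rewrite p0u p1u p2u !scale0r scale1r add0r subr0 mulr_algr.
Qed.

End AmbiskewRepresentation.

(** * Contractions and functoriality of tensor products *)

Section TensorTheory.
Variable k : fieldType.

Lemma tmap_bilinear (U V U' V' : lmodType k) (f : {linear U -> U'})
    (g : {linear V -> V'}) :
  bilinear_map (fun u v => f u ⊗' g v).
Proof.
split=> [v a u u' | u a v v'] /=; rewrite linearP.
  exact: (tpure_bilinear U' V').1.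
exact: (tpure_bilinear U' V').2.
Qed.

Lemma tmap_linear (U V U' V' : lmodType k) (f : {linear U -> U'})
    (g : {linear V -> V'}) :
  linear (tmap f g).
Proof. exact: tlift_linear (tmap_bilinear f g). Qed.

Lemma tmap_pure (U V U' V' : lmodType k) (f : {linear U -> U'})
    (g : {linear V -> V'}) u v :
  tmap f g (u ⊗' v) = f u ⊗' g v.
Proof. exact: tlift_pure (tmap_bilinear f g). Qed.

Lemma tensor_linear_ext (U V W : lmodType k) (f g : U ⊗ V -> W) :
  linear f -> linear g -> (forall u v, f (u ⊗' v) = g (u ⊗' v)) -> f =1 g.
Proof.
move=> flin glin fg.
pose f' : {linear U ⊗ V -> W} :=
  HB.pack f (GRing.isLinear.Build k _ _ *:%R _ flin).
pose g' : {linear U ⊗ V -> W} :=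
  HB.pack g (GRing.isLinear.Build k _ _ *:%R _ glin).
exact: (@tlift_uniq _ _ _ _ f' g').
Qed.

Lemma scale_bilinear (U V W : lmodType k) (f : {scalar U}) (g : {linear V -> W}) :
  bilinear_map (fun u v => f u *: g v).
Proof.
split=> [v a u u' | u a v v'] /=; rewrite linearP.
  by rewrite scalerDl scalerA.
by rewrite scalerDr !scalerA mulrC.
Qed.

Lemma scale_bilinear_swap (U V W : lmodType k) (f : {linear U -> W})
    (g : {scalar V}) :
  bilinear_map (fun u v => g v *: f u).
Proof.
split=> [v a u u' | u a v v'] /=; rewrite linearP.
  by rewrite scalerDr !scalerA mulrC.
by rewrite scalerDl scalerA.
Qed.

Lemma tlift_tmap (U V U' V' W : lmodType k) (i : {linear U -> U'})
    (j : {linear V -> V'}) (f : U' -> V' -> W) (g : U -> V -> W) t :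
  bilinear_map f -> bilinear_map g -> (forall u v, f (i u) (j v) = g u v) ->
  tlift f (tmap i j t) = tlift g t.
Proof.
move=> bf bg fg; move: t; apply: tensor_linear_ext => [a s t||u v].
- by rewrite tmap_linear (tlift_linear bf).
- exact: tlift_linear.
- by rewrite tmap_pure !tlift_pure.
Qed.

Lemma tlift_tmap0 (U V U' V' W : lmodType k) (i : {linear U -> U'})
    (j : {linear V -> V'}) (f : U' -> V' -> W) t :
  bilinear_map f -> (forall u v, f (i u) (j v) = 0) -> tlift f (tmap i j t) = 0.
Proof.
move=> bf f0; rewrite (@tlift_tmap _ _ _ _ _ _ _ _ (fun _ _ => 0)) //.
  by rewrite /tlift /tsum big1.
by split=> [v a u u'|u a v v'] /=; rewrite scaler0 addr0.
Qed.

End TensorTheory.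

Lemma tpureM (k : fieldType) (A B : algType k) (a c : A) (b d : B) :
  (a ⊗' b) * (c ⊗' d) = (a * c) ⊗' (b * d).
Proof. exact: tmul_pure. Qed.

(** The antipode axiom evaluated on [g ⊗' g]. *)
Lemma grouplike_mulV (k : fieldType) (A : hopfAlgType k) (g : A) :
  grouplike g -> g * antipode g = 1.
Proof.
case=> dg eg; have := antipoder g.
rewrite dg eg scale1r tlift_pure //; split=> [b a c c' | c a b b'] /=.
  by rewrite mulrDl scalerAl.
by rewrite linearP mulrDr scalerAr.
Qed.

(** * Comultiplying the defining relations of A *)

Section AmbiskewHopf.
Variables (k : fieldType) (R A : hopfAlgType k).
Variables (sigma : {lrmorphism R -> R}) (sigmaV : R -> R).
Hypotheses (sigmaK : cancel sigma sigmaV) (sigmaVK : cancel sigmaV sigma).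
Variables (h : R) (h_central : forall r : R, h * r = r * h).
Variables (xi : k) (xi_neq0 : xi != 0).
Variables (i : {lrmorphism R -> A}) (Xp Xm : A).
Hypothesis A_ambiskew : is_ambiskew sigma sigmaV h xi i Xp Xm.
Hypothesis R_hopf_sub : hopf_embedding i.
Variables yp ym : R.
Hypotheses (yp_grouplike : grouplike yp) (ym_grouplike : grouplike ym).
Hypothesis comul_Xp : comul Xp = Xp ⊗' 1 + i yp ⊗' Xp.
Hypothesis comul_Xm : comul Xm = Xm ⊗' 1 + i ym ⊗' Xm.

Let chi : {scalar R} := counit \o sigma.

Let coord c1 cp cm cu :=
  ambiskew_coord sigmaK sigmaVK xi_neq0 h_central c1 cp cm cu A_ambiskew.

Let XpE r : Xp * i r = i (sigma r) * Xp. Proof. by case: A_ambiskew => -[]. Qed.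
Let XmE r : Xm * i r = i (sigmaV r) * Xm. Proof. by case: A_ambiskew => -[]. Qed.
Let XpXmE : Xp * Xm = i h + xi *: (i 1 * (Xm * Xp)).
Proof. by rewrite rmorph1 mul1r; case: A_ambiskew => -[]. Qed.

Let comul_i r : comul (i r) = tmap i i (comul r).
Proof. by case: R_hopf_sub. Qed.

(* Both sides are Delta (Xp r) = Delta (sigma r Xp). *)
Lemma tlift_comul_sigma (W : lmodType k) (f : A -> A -> W) (g g' : R -> R -> W) r :
  bilinear_map f -> bilinear_map g -> bilinear_map g' ->
  (forall b c, f (i (sigma b) * Xp) (i c) + f (i (yp * b)) (i (sigma c) * Xp)
     = g b c) ->
  (forall b c, f (i b * Xp) (i c) + f (i (b * yp)) (i c * Xp) = g' b c) ->
  tlift g (comul r) = tlift g' (comul (sigma r)).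
Proof.
move=> bf bg bg' fg fg'.
have <- : tlift f (comul (Xp * i r)) = tlift g (comul r).
  rewrite rmorphM /= comul_Xp comul_i; move: (comul r).
  apply: tensor_linear_ext => [a s t||b c].
  (* The tensor product carries only a ring structure, so linearity of multiplication over k is
     taken from [tmul] directly. *)
  - by rewrite tmap_linear [X in tlift f X]tmulZDr (tlift_linear bf).
  - exact: tlift_linear.
  - rewrite tmap_pure mulrDl (tlift_add bf) !tpureM.
    by rewrite !tlift_pure // !XpE mul1r -rmorphM fg.
rewrite XpE rmorphM /= comul_Xp comul_i; move: (comul (sigma r)).
apply: tensor_linear_ext => [a s t||b c].
- by rewrite tmap_linear [X in tlift f X]tmulZDl (tlift_linear bf).
- exact: tlift_linear.
- rewrite tmap_pure mulrDr (tlift_add bf) !tpureM.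
  by rewrite !tlift_pure // mulr1 -rmorphM fg'.
Qed.

(** The coefficient of Xp in the left leg and of 1 in the right leg, with the counit applied to the
    left one. The terms carrying Xp on the right drop out, and the counit axiom rebuilds
    [sigma r]. *)
Lemma sigma_winding_l r : tlift (fun b c => chi b *: c) (comul r) = sigma r.
Proof.
have [p1 [p11 p1p _ _]] := coord 1 0 0 0.
have [pp [pp1 ppp _ _]] := coord 0 1 0 0.
rewrite -[RHS]counitl.
apply: (tlift_comul_sigma (f := fun x y => counit (pp x) *: p1 y)) => [|||b c|b c].
- exact: (scale_bilinear (counit \o pp)).
- exact: (scale_bilinear chi idfun).
- exact: (scale_bilinear (@counit k R) idfun).
- by rewrite ppp pp1 p11 !scale1r scale0r linear0 scale0r addr0.
- by rewrite ppp pp1 p11 !scale1r scale0r linear0 scale0r addr0.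
Qed.

(** The mirror image: Xp is now read in the right leg, and the factor [yp] survives in the left
    one. *)
Lemma sigma_winding_r r :
  tlift (fun b c => chi c *: (yp * b)) (comul r) = sigma r * yp.
Proof.
have [p1 [p11 p1p _ _]] := coord 1 0 0 0.
have [pp [pp1 ppp _ _]] := coord 0 1 0 0.
(* The counit axiom for [sigma r], with multiplication by [yp] carried inside the lift. *)
have -> : sigma r * yp = tlift (fun b c => counit c *: (b * yp)) (comul (sigma r)).
  rewrite -[in LHS](counitr (sigma r)); move: (comul (sigma r)).
  apply: tensor_linear_ext => [a s t||b c].
  - rewrite (tlift_linear (scale_bilinear_swap idfun (@counit k R))).
    by rewrite mulrDl scalerAl.
  - exact: tlift_linear (scale_bilinear_swap (yp \o* idfun) (@counit k R)).
  - rewrite (tlift_pure _ _ (scale_bilinear_swap idfun (@counit k R))).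
    rewrite (tlift_pure _ _ (scale_bilinear_swap (yp \o* idfun) (@counit k R))).
    by rewrite -scalerAl.
apply: (tlift_comul_sigma (f := fun x y => counit (pp y) *: p1 x)) => [|||b c|b c].
- exact: (scale_bilinear_swap p1 (counit \o pp)).
- exact: (scale_bilinear_swap (yp \*o idfun) chi).
- exact: (scale_bilinear_swap (yp \o* idfun) (@counit k R)).
- by rewrite ppp pp1 p1p p11 !scale1r scale0r linear0 scale0r add0r.
- by rewrite ppp pp1 p1p p11 !scale1r scale0r linear0 scale0r add0r.
Qed.

(** An arbitrary bilinear map applied to the comultiplied relation for Xp * Xm. Elements of R are
    moved to the left and factors [i 1] inserted, so that [ambiskew_coord] evaluates every term. *)
Lemma tlift_comul_h (W : lmodType k) (f : A -> A -> W) :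
  bilinear_map f ->
  let u := i 1 * (Xm * Xp) in
  f (i h + xi *: u) (i 1) + f (i (sigma ym) * Xp) (i 1 * Xm)
    + (f (i yp * Xm) (i 1 * Xp) + f (i (yp * ym)) (i h + xi *: u))
  = tlift f (tmap i i (comul h))
    + xi *: (f u (i 1) + f (i (sigmaV yp) * Xm) (i 1 * Xp)
             + (f (i ym * Xp) (i 1 * Xm) + f (i (ym * yp)) u)).
Proof.
move=> bf u.
rewrite -XpXmE -comul_i /u rmorph1 !mul1r.
have : comul (Xp * Xm) = comul (i h) + xi *: comul (Xm * Xp).
  by rewrite XpXmE linearD linearZ rmorph1 mul1r.
rewrite !rmorphM /= comul_Xp comul_Xm !mulrDl !mulrDr.
rewrite !tpureM.
move/(congr1 (tlift f)).
rewrite !(tlift_add bf) (tlift_scale bf) !(tlift_add bf).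
by rewrite !tlift_pure // !mul1r !mulr1 XpE XmE.
Qed.

(** The coefficient of Xp ⊗ Xm, with the counit applied to the right leg. *)
Lemma sigma_ym : sigma ym = xi *: ym.
Proof.
have [pp [pp1 ppp ppm ppu]] := coord 0 1 0 0.
have [pm [pm1 pmp pmm pmu]] := coord 0 0 1 0.
have bf := scale_bilinear_swap pp (counit \o pm).
have := tlift_comul_h bf.
(* Delta h lies in the image of R ⊗ R, and [pm] vanishes on the image of R. *)
rewrite tlift_tmap0 // => [|b c] /=; last by rewrite pm1 scale0r linear0 scale0r.
rewrite !linearD !linearZ /=.
by rewrite !(pp1, ppp, pm1, pmp, pmm, pmu, scale0r, scale1r, linear0, rmorph1,
  scaler0, mulr0, addr0, add0r).
Qed.

(** The coefficient of Xm ⊗ Xp. *)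
Lemma sigmaV_yp : yp = xi *: sigmaV yp.
Proof.
have [pp [pp1 ppp ppm ppu]] := coord 0 1 0 0.
have [pm [pm1 pmp pmm pmu]] := coord 0 0 1 0.
have bf := scale_bilinear_swap pm (counit \o pp).
have := tlift_comul_h bf.
rewrite tlift_tmap0 // => [|b c] /=; last by rewrite pp1 scale0r linear0 scale0r.
rewrite !linearD !linearZ /=.
by rewrite !(pm1, pmm, pp1, ppp, ppm, ppu, scale0r, scale1r, linear0, rmorph1,
  scaler0, mulr0, addr0, add0r).
Qed.

Lemma chi_ym : counit (sigma ym) = xi.
Proof. by case: ym_grouplike => _ ym1; rewrite sigma_ym linearZ /= ym1 mulr1. Qed.

Lemma chi_yp : counit (sigma yp) = xi.
Proof.
case: yp_grouplike => _ yp1.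
by rewrite sigmaV_yp linearZ /= sigmaVK linearZ /= yp1 mulr1.
Qed.

(** The coefficient of 1 ⊗ Xm Xp, after cancelling the nonzero [xi]. *)
Lemma ypym : yp * ym = ym * yp.
Proof.
have [p1 [p11 p1p p1m p1u]] := coord 1 0 0 0.
have [pu [pu1 pup pum puu]] := coord 0 0 0 1.
have bf := scale_bilinear_swap p1 (counit \o pu).
have := tlift_comul_h bf.
rewrite tlift_tmap0 // => [|b c] /=; last by rewrite pu1 scale0r linear0 scale0r.
rewrite !linearD !linearZ /=.
rewrite !(p11, p1p, p1m, p1u, pu1, pup, pum, puu, scale0r, scale1r, linear0,
  rmorph1, scaler0, mulr0, addr0, add0r, mulr1).
by apply: scalerI.
Qed.

(** The part over 1 ⊗ 1, contracted on the left by [chi]: Delta h becomes [sigma h] by the left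
    winding, and [chi (yp * ym)] is [xi ^ 2]. *)
Lemma sigma_h : sigma h = (counit (sigma h))%:A + xi ^+ 2 *: h.
Proof.
have [p1 [p11 p1p p1m p1u]] := coord 1 0 0 0.
have bf := scale_bilinear (chi \o p1) p1.
have := tlift_comul_h bf.
rewrite (tlift_tmap _ bf (scale_bilinear chi idfun)) => [|b c] /=; last first.
  by rewrite !p11 !scale1r.
rewrite [tlift _ _]sigma_winding_l !linearD !linearZ /=.
rewrite !(p11, p1p, p1m, p1u, scale0r, scale1r, linear0,
  rmorph1, scaler0, mulr0, addr0, add0r, mulr1).
by rewrite !rmorphM /= chi_yp chi_ym.
Qed.

(** The same part contracted on the right by [chi], with [yp] multiplied in so that the right
    winding applies. *)
Lemma sigma_h_yp : sigma h * yp = yp * (h + counit (sigma h) *: (yp * ym)).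
Proof.
have [p1 [p11 p1p p1m p1u]] := coord 1 0 0 0.
have bf := scale_bilinear_swap (yp \*o p1) (chi \o p1).
have := tlift_comul_h bf.
rewrite (tlift_tmap _ bf (scale_bilinear_swap (yp \*o idfun) chi)) => [|b c] /=;
  last by rewrite !p11 !scale1r.
rewrite [tlift _ _]sigma_winding_r !linearD !linearZ /=.
rewrite !(p11, p1p, p1m, p1u, scale0r, scale1r, linear0,
  rmorph1, scaler0, mulr0, addr0, add0r, mulr1).
by move=> <-; rewrite mulrDr scalerAr.
Qed.

Lemma ambiskew_h_eq : (xi ^+ 2 - 1) *: h = counit (sigma h) *: (ym * yp - 1).
Proof.
have ypV : yp * antipode yp = 1 by apply: grouplike_mulV.
have : sigma h = h + counit (sigma h) *: (ym * yp).
  (* Centrality of [h] and commutation of [yp] with [ym] let [yp] be cancelled against its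
     antipode. *)
  rewrite -[LHS]mulr1 -ypV mulrA sigma_h_yp ypym mulrDr mulrDl.
  rewrite -h_central -mulrA ypV mulr1; congr (_ + _).
  by rewrite -scalerAr -scalerAl -!mulrA ypV mulr1 ypym.
rewrite [in LHS]sigma_h => eq_h.
apply: (addrI h); rewrite scalerBr addrA -eq_h scalerBl scale1r.
by rewrite addrCA subrr addr0 addrAC subrr add0r.
Qed.
End AmbiskewHopf.

Theorem proposition3p1 (k : fieldType) (R A : hopfAlgType k)
    (sigma : {lrmorphism R -> R}) (sigmaV : R -> R)
    (sigmaK : cancel sigma sigmaV) (sigmaVK : cancel sigmaV sigma)
    (h : R) (h_central : forall r : R, h * r = r * h)
    (xi : k) (xi_neq0 : xi != 0)
    (i : {lrmorphism R -> A}) (Xp Xm : A)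
    (A_ambiskew : is_ambiskew sigma sigmaV h xi i Xp Xm)
    (R_hopf_sub : hopf_embedding i)
    (yp ym : R) (yp_grouplike : grouplike yp) (ym_grouplike : grouplike ym)
    (comul_Xp : comul Xp = Xp ⊗' 1 + i yp ⊗' Xp)
    (comul_Xm : comul Xm = Xm ⊗' 1 + i ym ⊗' Xm) :
  let chi : R -> k := fun r => counit (sigma r) in
  let z : R := ym * yp in
  [\/ (xi = 1 \/ xi = -1) /\ chi h = 0,
      (xi = 1 \/ xi = -1) /\ z = 1
    | ~ (xi = 1 \/ xi = -1) /\ h = (chi h / (xi ^+ 2 - 1)) *: (z - 1)].
Proof.
move=> chi z.
have : (xi ^+ 2 - 1) *: h = chi h *: (z - 1).
  exact: (ambiskew_h_eq sigmaK sigmaVK h_central xi_neq0 A_ambiskew).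
have [xi2|xi2] := eqVneq (xi ^+ 2) 1.
  have xi1 : xi = 1 \/ xi = -1.
    by move/eqP: xi2; rewrite sqrf_eq1 => /orP[]/eqP; [left | right].
  (* The left side vanishes, so either the scalar [chi h] or the vector [z - 1] is zero. *)
  rewrite xi2 subrr scale0r => /esym/eqP.
  rewrite scaler_eq0 subr_eq0 => /orP[] /eqP; first by constructor 1.
  by constructor 2.
move=> eq_h; constructor 3; split.
  by move=> xi1; move/negP: xi2; apply; rewrite sqrf_eq1; apply/orP;
    case: xi1 => /eqP; [left | right].
by rewrite mulrC -scalerA -eq_h scalerA mulVf ?scale1r // subr_eq0.
Qed.
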